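(* Let $Q_n$ be the $n$-dimensional hypercube graph and, for nonnegative integers $r$, let $K(n,r)$ be the minimum number of balls of radius $r$ in $Q_n$ whose union is $V(Q_n)$. Then: (i) $n \le A(Q_n) \le n-1+\lceil \log(n+1)\rceil$. (ii) $K(n,r)-1 \le A(Q_n,\le r) \le K(n,r)+n-1+\lceil \log(r+1)\rceil$. Moreover, there is a constant $C$ such that if $r \le n/2 - C\sqrt{n}\log n$, then $A(Q_n,\le r)=(1+o(1))K(n,r)$ as $n\to\infty$. (iii) $K(n,r)-1 \le A(Q_n,r) \le K(n,r)+\sum_{i=0}^r \binom{n}{i}$. Moreover, there is a constant $C'$ such that if $r \le C'n$, then $A(Q_n,r)=(1+o(1))K(n,r)$ as $n\to\infty$.
   Context: $Q_n$ is the graph on the set of all $0$-$1$ vectors of length $n$, two vectors adjacent iff they differ in exactly one coordinate; the graph distance is the Hamming distance. For a graph $G$, a vertex $u$ and integer $r\ge 0$, the ball $B(u,r)$ is the set of vertices at distance at most $r$ from $u$. In the search problem an unknown vertex $v\in V(G)$ must be determined by queries of the form ''is $v\in B(u,r)$?''. $A(G,r)$ is the minimum number of queries needed in the worst case to determine $v$ adaptively (each query may depend on previous answers) when all queried balls have radius exactly $r$; $A(G,\le r)$ is the same when queried balls may have any radius at most $r$; $A(G)$ is the same when balls of any radius are allowed. ''$\log$'' denotes logarithm to base 2. *)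

(* Defs.v *)
From HB Require Import structures.
From mathcomp Require Import all_boot all_order all_algebra.
From mathcomp Require Import all_classical all_reals all_analysis.

Set Implicit Arguments.
Unset Strict Implicit.
Unset Printing Implicit Defensive.

Import Order.TTheory GRing.Theory Num.Theory.

Section Graph.
Variables (V : finType) (e : rel V).

(* Graph distance at most r: a walk with at most r edges joins u to w. *)
Definition within (r : nat) (u w : V) : bool :=
  [exists k : 'I_r.+1, [exists p : k.-tuple V, path e u p && (last u p == w)]].

Definition ball (u : V) (r : nat) : {set V} := [set w | within r u w].

Definition covering (r : nat) (C : {set V}) : bool :=
  (\bigcup_(u in C) ball u r)%SET == [set: V]%SET.

(* The set of all vertices is covering (see covering_setT), so the minimum is
   attained at a genuine covering. *)
Definition covering_number (r : nat) : nat :=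
  #|[arg min_(C < [set: V]%SET | covering r C) #|C| ]|.

(* An adaptive search: [Ask u r t1 t0] asks whether the unknown vertex is in
   the ball B(u, r), continuing with t1 if so and with t0 otherwise. *)
Inductive strategy : Type :=
| Answer of V
| Ask of V & nat & strategy & strategy.

Fixpoint outcome (t : strategy) (v : V) : V :=
  match t with
  | Answer w => w
  | Ask u r t1 t0 => if v \in ball u r then outcome t1 v else outcome t0 v
  end.

Fixpoint queries (t : strategy) (v : V) : nat :=
  match t with
  | Answer _ => 0
  | Ask u r t1 t0 =>
      (if v \in ball u r then queries t1 v else queries t0 v).+1
  end.

Definition worst_case (t : strategy) : nat := \max_(v : V) queries t v.

Fixpoint allowed (P : pred nat) (t : strategy) : bool :=
  match t with
  | Answer _ => true
  | Ask _ r t1 t0 => [&& P r, allowed P t1 & allowed P t0]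
  end.

Definition determines (t : strategy) : Prop := forall v, outcome t v = v.

(* Minimum worst-case number of queries with balls whose radius satisfies P; it
   is +oo when no strategy using only such balls determines every vertex. *)
Definition search_number (R : realType) (P : pred nat) : \bar R :=
  ereal_inf [set (worst_case t)%:R%:E%R
            | t in [set t | allowed P t /\ determines t]].

End Graph.

Definition cube (n : nat) : finType := n.-tuple bool.

Definition hamming (n : nat) (x y : cube n) : nat :=
  #|[set i : 'I_n | tnth x i != tnth y i]%SET|.

Definition cube_adj (n : nat) : rel (cube n) := fun x y => hamming x y == 1.

Definition A (R : realType) (n : nat) : \bar R :=
  search_number (@cube_adj n) R predT.

Definition A_le (R : realType) (n r : nat) : \bar R :=
  search_number (@cube_adj n) R (fun s => s <= r).

Definition A_eq (R : realType) (n r : nat) : \bar R :=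
  search_number (@cube_adj n) R (fun s => s == r).

Definition K (n r : nat) : nat := covering_number (@cube_adj n) r.

Definition log2 (R : realType) (x : R) : R := (ln x / ln 2)%R.

Lemma mem_ball (V : finType) (e : rel V) (u w : V) (r : nat) :
  reflect (exists p : seq V, [/\ size p <= r, path e u p & last u p = w])
          (w \in ball e u r).
Proof.
rewrite inE; apply: (iffP existsP) => [[k /existsP[p /andP[up /eqP <-]]]|].
  by exists p; split=> //; rewrite size_tuple -ltnS ltn_ord.
case=> p [pr up uw]; have pr' : size p < r.+1 by [].
exists (Ordinal pr'); apply/existsP; exists (in_tuple p).
by rewrite up uw eqxx.
Qed.

Lemma covering_setT (V : finType) (e : rel V) (r : nat) :
  covering e r [set: V]%SET.
Proof.
rewrite /covering -finset.subTset; apply/fintype.subsetP => v _.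
by apply/bigcupP; exists v => //; apply/mem_ball; exists [::].
Qed.

Lemma hamming_triangle (n : nat) (x y z : cube n) :
  hamming x z <= hamming x y + hamming y z.
Proof.
apply: leq_trans (leq_card_setU _ _); apply/subset_leq_card/fintype.subsetP => i.
by rewrite !inE; case: (tnth x i); case: (tnth y i); case: (tnth z i).
Qed.

Lemma ball_cube (n : nat) (x y : cube n) (r : nat) :
  (y \in ball (@cube_adj n) x r) = (hamming x y <= r).
Proof.
apply/mem_ball/idP => [[p []]|].
  elim: p x r => [|z p IHp] x r /=.
    move=> _ _ ->; suff -> : hamming y y = 0 by [].
    by apply/eqP; rewrite cards_eq0; apply/eqP/setP => i; rewrite !inE eqxx.
  case: r => // r pr /andP[/eqP xz zp] zy.
  by apply: leq_trans (hamming_triangle x z y) _; rewrite xz ltnS; exact: IHp.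
elim: r x => [|r IHr] x xy.
  exists [::]; split=> //=; apply: eq_from_tnth => i; apply/eqP.
  move: xy; rewrite leqn0 cards_eq0 => /eqP/setP/(_ i).
  by rewrite !inE => /negbFE.
have [xy0|[i]] := set_0Vmem [set i : 'I_n | tnth x i != tnth y i]%SET.
  have [|p [pr xp py]] := IHr x; first by rewrite /hamming xy0 cards0.
  by exists p; split=> //; exact: leqW.
rewrite inE => xyi.
pose z : cube n := [tuple if j == i then tnth y i else tnth x j | j < n].
have zE j : tnth z j = if j == i then tnth y i else tnth x j.
  by rewrite tnth_mktuple.
have xz : cube_adj x z.
  apply/cards1P; exists i; apply/setP => j; rewrite !inE zE.
  by case: (j =P i) => [->|_] //; rewrite eqxx.
have [|p [pr zp py]] := IHr z.
  move: xy; rewrite /hamming (cardsD1 i) inE xyi add1n ltnS.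
  apply: leq_trans; apply/subset_leq_card/fintype.subsetP => j; rewrite !inE zE.
  by case: (j =P i) => [->|_] //; rewrite eqxx.
by exists (z :: p); split=> //=; rewrite xz.
Qed.

(* Main.v *)
Require Import Defs.
From mathcomp Require Import all_boot all_order all_algebra.
From mathcomp Require Import all_classical all_reals all_analysis.
From mathcomp Require Import zify ring lra.
Import Order.TTheory GRing.Theory Num.Theory.

(** Upper bounds: query the balls of an optimal covering until one contains the
unknown vertex [v]. With radii at most [r], a binary search then finds the
distance [w] from [v] to the centre [u], and the ball of radius [w - 1] around
[u] with one coordinate flipped reveals that coordinate of [v]; (i) is the case
[r = n]. With radius exactly [r < n], any two vertices are separated by some
ball, so each further query discards at least one candidate.

Lower bounds: the balls on the all-negative branch of a strategy, together with
its final answer, cover the cube; for (i), a binary tree with [2 ^ n] leaves has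
depth at least [n].

Asymptotics: with [V] the size of a ball, [2 ^ n <= K * V] and
[V * x ^ r <= (1 + x) ^ n] for [0 <= x <= 1]. In (ii), [x = exp (- 1 / sqrt n)]
gives [K >= 3 / 4 * n ^ 3], which dominates the [2 n] additional queries; in
(iii), [x = 1 / 4] and [r <= n / 16] give [V ^ 2 <= (15 / 8) ^ n], hence
[V <= (15 / 16) ^ n * K]. *)

(** * Search strategies on an arbitrary graph *)

Section Search.
Set Implicit Arguments.
Unset Strict Implicit.
Local Notation ball := Defs.ball.
Variables (V : finType) (e : rel V).
Implicit Types (P : pred nat) (S C : {set V}) (t : strategy V).

(** [S] holds the candidates compatible with the answers so far; outside [S] the strategy may err,
    which lets strategies be built by induction on [S]. *)
Definition solvable P S b :=
  exists2 t, allowed P t &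
    forall v, v \in S -> outcome e t v = v /\ queries e t v <= b.

Lemma solvable_sub P S S' b b' :
  S' \subset S -> b <= b' -> solvable P S b -> solvable P S' b'.
Proof.
move=> /fintype.subsetP sS lb [t Pt tS]; exists t => // v /sS /tS[-> q].
by split=> //; exact: leq_trans lb.
Qed.

Lemma solvable_set1 P w b : solvable P [set w]%SET b.
Proof. by exists (Answer w) => // v; rewrite inE => /eqP ->. Qed.

Lemma solvable_ask P S u s b :
  P s -> solvable P (S :&: ball e u s)%SET b ->
  solvable P (S :\: ball e u s)%SET b -> solvable P S b.+1.
Proof.
move=> Ps [t1 P1 h1] [t0 P0 h0]; exists (Ask u s t1 t0); first by rewrite /= Ps P1.
move=> v vS /=; case: ifPn => vu.
  by have [|-> q] := h1 v; [rewrite inE vS|split].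
by have [|-> q] := h0 v; [rewrite inE vu|split].
Qed.

(* The last ball of the covering need not be queried. *)
Lemma solvable_cover P S C r b : P r -> 0 < #|C| ->
  S \subset (\bigcup_(u in C) ball e u r)%SET ->
  (forall u, u \in C -> solvable P (ball e u r) b) ->
  solvable P S (#|C|.-1 + b).
Proof.
move=> Pr; move Em : #|C| => m; elim: m C S Em => // m IHm C S Cm _ SC h.
have /card_gt0P[u uC] : 0 < #|C| by rewrite Cm.
have Cum : #|(C :\ u)%SET| = m by move: Cm; rewrite (cardsD1 u) uC => -[].
have SC' : S :\: ball e u r \subset (\bigcup_(w in C :\ u) ball e w r)%SET.
  apply/fintype.subsetP => v /finset.setDP[vS vu].
  have /bigcupP[w wC vw] := fintype.subsetP SC v vS.
  apply/bigcupP; exists w => //; rewrite !inE wC andbT.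
  by apply: contraNneq vu => <-.
case: m => [|m] in IHm Cm Cum *.
  apply: solvable_sub (h u uC) => //; rewrite -finset.setD_eq0 -finset.subset0.
  apply: fintype.subset_trans SC' _.
  by rewrite (cards0_eq Cum) big_set0.
rewrite /= addSn; apply: (@solvable_ask _ _ u r) => //.
  by apply: solvable_sub (h u uC); [exact: finset.subsetIr|exact: leq_addl].
by apply: (IHm (C :\ u)%SET) => // w; rewrite inE => /andP[_]; exact: h.
Qed.

(** A ball separating two candidates leaves both parts of [S] nonempty, so either answer removes at
    least one candidate. The vertex [v0] is a default answer when [S] is empty. *)
Lemma solvable_separated P (v0 : V) S :
  (forall x y, x != y ->
     exists u s, [/\ P s, x \in ball e u s & y \notin ball e u s]) ->
  solvable P S #|S|.-1.
Proof.
move=> sep; have [m] := ubnP #|S|; elim: m S => // m IHm S Sm.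
have [S1|] := leqP #|S| 1.
  move: S1; rewrite leq_eqVlt ltnS leqn0 cards_eq0 => /orP[/cards1P[w ->]|/eqP ->].
    exact: solvable_set1.
  by apply: solvable_sub (solvable_set1 P v0 0) => //; exact: finset.sub0set.
move=> S2; have /card_gt1P[x [y [xS yS xy]]] := S2.
have [u [s [Ps xu yu]]] := sep x y xy.
have S1 : 0 < #|(S :&: ball e u s)%SET| by apply/card_gt0P; exists x; rewrite inE xS.
have S0 : 0 < #|(S :\: ball e u s)%SET|.
  by apply/card_gt0P; exists y; rewrite inE yS yu.
have SE := cardsID (ball e u s) S.
have -> : #|S|.-1 = #|S|.-2.+1 by lia.
apply: solvable_ask Ps _ _.
  by apply: solvable_sub (IHm (S :&: ball e u s)%SET _) => //; lia.
by apply: solvable_sub (IHm (S :\: ball e u s)%SET _) => //; lia.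
Qed.

Lemma search_number_le (R : realType) P b :
  solvable P [set: V]%SET b -> (search_number e R P <= b%:R%:E)%E.
Proof.
case=> t Pt tV; apply: ge_ereal_inf; exists (worst_case e t)%:R%:E%R.
  by exists t => //; split=> // v; case: (tV v).
by rewrite lee_fin ler_nat; apply/bigmax_leqP => v _; case: (tV v).
Qed.

Lemma search_number_ge (R : realType) P (x : R) :
  (forall t m, allowed P t -> determines e t ->
     (forall v, queries e t v <= m) -> (x <= m%:R)%R) ->
  (x%:E <= search_number e R P)%E.
Proof.
move=> h; apply: le_ereal_inf_tmp => _ [t [Pt tV] <-]; rewrite lee_fin.
by apply: (h t) => // v; exact: (leq_bigmax v).
Qed.

(** The first answer splits [S] into two parts, each handled by a subtree with one query fewer. *)
Lemma leq_card_queries t m S :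
  (forall v, v \in S -> outcome e t v = v /\ queries e t v <= m) ->
  #|S| <= 2 ^ m.
Proof.
elim: t m S => [w|u s t1 IH1 t0 IH0] m S h.
  apply: (@leq_trans #|[set w]%SET|); last by rewrite cards1 expn_gt0.
  by apply/subset_leq_card/fintype.subsetP => v /h[/= <-]; rewrite inE.
case: m h => [|m] h.
  have -> : S = finset.set0; last by rewrite cards0.
  by apply/setP => v; rewrite inE; apply/negP => /h[].
rewrite -(cardsID (ball e u s) S) expnS mul2n -addnn; apply: leq_add.
  by apply: IH1 => v /finset.setIP[/h /=] + vu; rewrite vu.
by apply: IH0 => v /finset.setDP[/h /=] + vu; rewrite (negPf vu).
Qed.

(* Along the all-negative branch, the queried balls together with the vertex
   finally answered cover everything. *)
Lemma covering_queries t r m S : allowed (fun s => s <= r) t ->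
  (forall v, v \in S -> outcome e t v = v /\ queries e t v <= m) ->
  exists2 C : {set V}, #|C| <= m.+1 & S \subset (\bigcup_(u in C) ball e u r)%SET.
Proof.
have ball_sub s u v : s <= r -> v \in ball e u s -> v \in ball e u r.
  move=> sr /mem_ball[p [ps up uv]]; apply/mem_ball.
  by exists p; split=> //; exact: leq_trans sr.
elim: t m S => [w|u s t1 _ t0 IH0] m S /=.
  move=> _ h; exists [set w]%SET; first by rewrite cards1.
  apply/fintype.subsetP => v /h[/= -> _]; rewrite big_set1.
  by apply/mem_ball; exists [::].
move=> /and3P[sr _ P0] h; case: m h => [|m] h.
  exists finset.set0; first by rewrite cards0.
  by apply/fintype.subsetP => v /h[].
have [v /finset.setDP[/h + vu]|C Cm SC] := IH0 m (S :\: ball e u s)%SET P0.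
  by rewrite (negPf vu).
exists (u |: C)%SET; first by rewrite cardsU1; case: (_ \in _); lia.
apply/fintype.subsetP => v vS; apply/bigcupP.
have [vu|vu] := boolP (v \in ball e u s).
  by exists u; [exact: setU11|exact: ball_sub vu].
have /(fintype.subsetP SC)/bigcupP[w wC vw] : v \in S :\: ball e u s.
  by rewrite inE vu.
by exists w => //; exact: setU1r.
Qed.

Lemma covering_number_le r C : covering e r C -> covering_number e r <= #|C|.
Proof.
rewrite /covering_number => hC.
by case: arg_minnP => [|D _]; [exact: covering_setT|exact].
Qed.

Lemma covering_numberP r :
  exists2 C : {set V}, covering e r C & #|C| = covering_number e r.
Proof.
rewrite /covering_number; case: arg_minnP => [|D hD _]; first exact: covering_setT.
by exists D.
Qed.

Lemma search_number_ge_covering (R : realType) P r : subpred P (fun s => s <= r) ->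
  ((((covering_number e r)%:R - 1)%R)%:E <= search_number e R P)%E.
Proof.
move=> Pr; apply: search_number_ge => t m Pt tV tm.
have {}Pt : allowed (fun s => s <= r) t.
  elim: t Pt {tV tm} => //= u s t1 IH1 t0 IH0 /and3P[Ps P1 P0].
  by rewrite Pr // IH1 // IH0.
have [C Cm VC] : exists2 C : {set V}, #|C| <= m.+1 &
    [set: V]%SET \subset (\bigcup_(u in C) ball e u r)%SET.
  by apply: covering_queries Pt _ => v _; split; [exact: tV|exact: tm].
have : covering_number e r <= m.+1.
  by apply: leq_trans Cm; apply: covering_number_le; rewrite /covering -finset.subTset.
by rewrite lerBlDr natr1 ler_nat.
Qed.

End Search.

(** * Strategies and covering bounds in the hypercube *)

Section Cube.
Set Implicit Arguments.
Unset Strict Implicit.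
Variable n : nat.
Local Notation ball := (Defs.ball (@cube_adj n)).
Local Notation solvable := (solvable (@cube_adj n)).
Implicit Types (u v x y : cube n) (S C : {set cube n}) (P : pred nat).

Definition flip u (i : 'I_n) : cube n :=
  [tuple if j == i then ~~ tnth u j else tnth u j | j < n].

Lemma tnth_flip u i j : tnth (flip u i) j = (j == i) (+) tnth u j.
Proof. by rewrite tnth_mktuple; case: eqP. Qed.

(** The distance moves by one, down or up; the boolean summands express both cases without
    subtraction. *)
Lemma hamming_flip u v i :
  hamming (flip u i) v + (tnth u i != tnth v i) =
  hamming u v + (tnth u i == tnth v i).
Proof.
rewrite /hamming (cardsD1 i) [X in _ = X + _](cardsD1 i) !inE tnth_flip eqxx /=.
set X := #|_|; set Y := #|_|; have -> : X = Y.
  apply: eq_card => j; rewrite !inE tnth_flip.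
  by case: eqP.
by case: (tnth u i); case: (tnth v i) => /=; lia.
Qed.

Lemma hamming_eq0 u v : (hamming u v == 0) = (u == v).
Proof.
rewrite cards_eq0; apply/eqP/eqP => [/setP uv|->].
  apply: eq_from_tnth => i; apply/eqP.
  by have := uv i; rewrite !inE => /negbFE.
by apply/setP => i; rewrite !inE eqxx.
Qed.

Lemma hamming_max u v : hamming u v <= n.
Proof. by rewrite -[leqRHS]card_ord max_card. Qed.

(* [J] is the set of unknown coordinates; the last one is determined by [w]. *)
Lemma solvable_level P u w (J : {set 'I_n}) S : P w.-1 ->
  (forall v, v \in S -> hamming u v = w) ->
  (forall v v' i, v \in S -> v' \in S -> i \notin J -> tnth v i = tnth v' i) ->
  solvable P S #|J|.-1.
Proof.
move=> Pw; move Em : #|J| => m; elim: m J S Em => [|m IHm] J S Jm Sw SJ.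
  have [->|[x xS]] := set_0Vmem S.
    by apply: solvable_sub (solvable_set1 _ P u 0) => //; exact: finset.sub0set.
  apply: solvable_sub (solvable_set1 _ P x 0) => //.
  apply/fintype.subsetP => v vS; rewrite inE; apply/eqP/eq_from_tnth => i.
  by apply: SJ => //; rewrite (cards0_eq Jm) inE.
have /card_gt0P[i iJ] : 0 < #|J| by rewrite Jm.
have Jim : #|(J :\ i)%SET| = m by move: Jm; rewrite (cardsD1 i) iJ => -[].
have ballE v : v \in S -> 0 < w ->
    (v \in ball (flip u i) w.-1) = (tnth u i != tnth v i).
  move=> vS w0; rewrite ball_cube; have := hamming_flip u v i; rewrite Sw //.
  by case: eqP => _ /=; lia.
have [->|[x xS]] := set_0Vmem S.
  by apply: solvable_sub (solvable_set1 _ P u 0) => //; exact: finset.sub0set.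
(* At distance 0 the radius [w.-1] is truncated and the test fails, but [u] is then the only
   possible candidate. *)
have [w0|w0] := posnP w.
  apply: solvable_sub (solvable_set1 _ P u 0) => //.
  apply/fintype.subsetP => v /Sw; rewrite w0 inE eq_sym => /eqP.
  by rewrite hamming_eq0.
case: m => [|m] in IHm Jm Jim *.
  apply: solvable_sub (solvable_set1 _ P x 0) => //.
  apply/fintype.subsetP => v vS; rewrite inE; apply/eqP/eq_from_tnth => j.
  have vx k : k != i -> tnth v k = tnth x k.
    move=> ki; apply: SJ => //; apply: contra_eqN Jim => kJ.
    by rewrite (cardsD1 k) !inE ki kJ.
  have [->|/vx//] := eqVneq j i.
  (* Outside [i] the two vertices agree, so their equal distances to [u] force agreement at [i] as
     well. *)
  have : hamming u v = hamming u x by rewrite !Sw.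
  rewrite /hamming (cardsD1 i) [RHS](cardsD1 i) !inE.
  set X := #|_|; set Y := #|_|; have -> : X = Y.
    by apply: eq_card => k; rewrite !inE; case: eqVneq => //= /vx ->.
  by move/addIn; case: (tnth u i); case: (tnth v i); case: (tnth x i).
apply: (@solvable_ask _ _ _ _ (flip u i) w.-1) => //.
  apply: (IHm (J :\ i)%SET) => // [v /finset.setIP[/Sw]//|v v' j].
  move=> /finset.setIP[vS vb] /finset.setIP[vS' vb'].
  rewrite !inE negb_and negbK => /orP[/eqP ->|]; last exact: SJ.
  move: vb vb'; rewrite !ballE //.
  by case: (tnth u i); case: (tnth v i); case: (tnth v' i).
apply: (IHm (J :\ i)%SET) => // [v /finset.setDP[/Sw]//|v v' j].
move=> /finset.setDP[vS vb] /finset.setDP[vS' vb'].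
rewrite !inE negb_and negbK => /orP[/eqP ->|]; last exact: SJ.
move: vb vb'; rewrite !ballE //.
by case: (tnth u i); case: (tnth v i); case: (tnth v' i).
Qed.

Lemma solvable_bisect P u r k a b S :
  (forall s, s <= r -> P s) ->
  (forall v, v \in S -> a <= hamming u v < a + 2 ^ k /\ hamming u v <= r) ->
  (forall w, w <= r -> solvable P [set v | hamming u v == w]%SET b) ->
  solvable P S (k + b).
Proof.
move=> Pr + lvl; elim: k a S => [|k IHk] a S Sa.
  have [ar|ar] := leqP a r.
    apply: solvable_sub (lvl a ar) => //; apply/fintype.subsetP => v /Sa[].
    by rewrite inE expn0 addn1 ltnS => /andP[? ?] _; rewrite eqn_leq; apply/andP; split.
  apply: solvable_sub (solvable_set1 _ P u 0) => //; apply/fintype.subsetP => v /Sa[].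
  by move=> /andP[av _] vr; move: (leq_trans av vr); rewrite leqNgt ar.
(* The midpoint is queried only if it is at most [r], which keeps the radius admissible; otherwise
   the upper half is empty and the interval shrinks for free. *)
have [akr|akr] := leqP (a + 2 ^ k) r.
  rewrite addSn; apply: (@solvable_ask _ _ _ _ u (a + 2 ^ k).-1).
  - by apply: Pr; lia.
  - apply: (IHk a) => v /finset.setIP[/Sa[]]; rewrite ball_cube.
    by have := expn_gt0 2 k; lia.
  - apply: (IHk (a + 2 ^ k)) => v /finset.setDP[/Sa[]]; rewrite ball_cube expnS.
    by have := expn_gt0 2 k; lia.
apply: (@solvable_sub _ _ _ S _ (k + b)) => //.
by apply: (IHk a) => v /Sa; lia.
Qed.

Lemma K_gt0 r : 0 < K n r.
Proof.
rewrite /K; have [C hC <-] := covering_numberP (@cube_adj n) r.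
move: hC; rewrite /covering lt0n; apply: contraTneq => /cards0_eq ->.
rewrite big_set0 eq_sym -finset.subset0; apply/negP => /fintype.subsetP.
by move=> /(_ [tuple of nseq n true]); rewrite !inE => /(_ isT).
Qed.

Lemma solvable_K P r b : P r -> (forall u, solvable P (ball u r) b) ->
  solvable P [set: cube n]%SET ((K n r).-1 + b).
Proof.
move=> Pr h; have K0 := K_gt0 r.
have [C hC CE] := covering_numberP (@cube_adj n) r.
rewrite /K -CE; apply: solvable_cover Pr _ _ _ => //; first by rewrite CE.
by rewrite (eqP hC).
Qed.

Lemma solvable_le_K P r k : (forall s, s <= r -> P s) -> r < 2 ^ k ->
  solvable P [set: cube n]%SET ((K n r).-1 + (k + n.-1)).
Proof.
move=> Pr rk; apply: solvable_K => [|u]; first exact: Pr.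
apply: (@solvable_bisect _ u r k 0) => // [v|w wr].
  by rewrite ball_cube; lia.
rewrite -[in n.-1](card_ord n) -cardsT.
apply: (@solvable_level _ u w) => [|v|v v' i _ _]; last by rewrite inE.
  by apply: Pr; lia.
by rewrite inE => /eqP.
Qed.

(** Start at the centre [x] with radius 0. If increasing the radius to [r.+1] captures [y], then [y]
    lies at distance exactly [r.+1 < n], so the centre agrees with [y] somewhere; flipping that
    coordinate pushes [y] out again and moves [x] by at most one. *)
Lemma separating_ball r x y : r < n -> x != y ->
  exists u, hamming u x <= r < hamming u y.
Proof.
move=> + xy; elim: r => [|r IHr] rn.
  by exists x; rewrite lt0n !hamming_eq0 xy leqn0 hamming_eq0 eqxx.
have [u /andP[ux uy]] := IHr (ltnW rn).
have [ruy|] := ltnP r.+1 (hamming u y); first by exists u; rewrite ruy (leqW ux).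
move=> uyr; have {uyr}uyE : hamming u y = r.+1 by lia.
have [i uyi] : exists i, tnth u i = tnth y i.
  have [/forallP h|/existsP[i /negPn/eqP ?]] := boolP [forall i, tnth u i != tnth y i].
    have : hamming u y = n; last by lia.
    by rewrite -[RHS]card_ord -cardsT; apply: eq_card => i; rewrite !inE h.
  by exists i.
exists (flip u i); have := hamming_flip u y i; have := hamming_flip u x i.
rewrite uyi eqxx /=.
by case: eqP => _ /=; lia.
Qed.

(** A vertex is encoded by the set of coordinates where it differs from [u]. *)
Lemma card_ball_cube u r : #|ball u r| <= \sum_(i < r.+1) 'C(n, i).
Proof.
pose D v := [set i : 'I_n | tnth u i != tnth v i]%SET.
have Dinj : injective D.
  move=> v w /setP vw; apply: eq_from_tnth => i; have := vw i; rewrite !inE.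
  by case: (tnth u i); case: (tnth v i); case: (tnth w i).
rewrite -(card_imset _ Dinj).
have /subset_leq_card/leq_trans-> // : D @: ball u r \subset
    (\bigcup_(i < r.+1) [set A : {set 'I_n} | #|A| == i])%SET.
  apply/fintype.subsetP => _ /imsetP[v + ->]; rewrite ball_cube => uv.
  by apply/bigcupP; exists (Ordinal (n := r.+1) uv); rewrite ?inE.
elim/big_rec2: _ => [|i m X _ Xm]; first by rewrite cards0.
apply: leq_trans (leq_card_setU _ _) _; apply: leq_add => //.
by rewrite card_draws card_ord.
Qed.

(** The sphere-covering bound. *)
Lemma leq_expn_K r : 2 ^ n <= K n r * \sum_(i < r.+1) 'C(n, i).
Proof.
have [C hC CE] := covering_numberP (@cube_adj n) r.
rewrite /K -CE -sum_nat_const.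
have -> : 2 ^ n = #|[set: cube n]%SET| by rewrite cardsT card_tuple card_bool.
rewrite -(eqP hC); apply: leq_trans (_ : \sum_(u in C) #|ball u r| <= _); last first.
  by apply: leq_sum => u _; exact: card_ball_cube.
elim/big_rec2: _ => [|u m X _ Xm]; first by rewrite cards0.
by apply: leq_trans (leq_card_setU _ _) _; rewrite leq_add2l.
Qed.

Lemma solvable_eq_K r : r < n ->
  solvable (fun s => s == r) [set: cube n]%SET
    (K n r + \sum_(i < r.+1) 'C(n, i)).
Proof.
move=> rn; apply: (@solvable_sub _ _ _ [set: cube n]%SET _
  ((K n r).-1 + (\sum_(i < r.+1) 'C(n, i)))) => //; first by rewrite leq_add2r leq_pred.
apply: solvable_K => // u.
apply: (@solvable_sub _ _ _ (ball u r) _ #|ball u r|.-1) => //.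
  by apply: leq_trans (leq_pred _) _; exact: card_ball_cube.
apply: (solvable_separated u) => x y xy.
have [w /andP[wx wy]] := separating_ball rn xy.
by exists w, r; rewrite !ball_cube wx -ltnNge.
Qed.

Lemma A_ge (R : realType) : (n%:R%:E <= A R n)%E.
Proof.
apply: search_number_ge => t m _ tV tm; rewrite ler_nat -(leq_exp2l (m := 2)) //.
have -> : 2 ^ n = #|[set: cube n]%SET| by rewrite cardsT card_tuple card_bool.
by apply: (@leq_card_queries _ _ t) => v _; split.
Qed.

End Cube.

(** * Growth of the covering number *)

Section Asymptotics.
Set Implicit Arguments.
Unset Strict Implicit.
Local Open Scope ring_scope.
Variable R : realType.
Implicit Types (n r : nat) (x y z eps : R).

Lemma bernoulli_ineq n x : -1 <= x -> 1 + n%:R * x <= (1 + x) ^+ n.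
Proof.
move=> x1; elim: n => [|n IHn]; first by rewrite expr0 mul0r addr0.
rewrite exprS; apply: (@le_trans _ _ ((1 + x) * (1 + n%:R * x))).
  have := ler0n R n; have := sqr_ge0 x; rewrite -natr1; nra.
by apply: ler_wpM2l IHn; lra.
Qed.

(** Since [x ^+ r <= x ^+ i] for [i <= r], the left side is at most a truncated binomial expansion
    of the right. *)
Lemma sum_bin_le n r x : (r <= n)%N -> 0 <= x <= 1 ->
  (\sum_(i < r.+1) 'C(n, i))%N%:R * x ^+ r <= (1 + x) ^+ n.
Proof.
move=> rn /andP[x0 x1]; rewrite addrC exprD1n natr_sum big_distrl /=.
rewrite (big_ord_widen n.+1 (fun i => 'C(n, i)%:R * x ^+ r)) ?ltnS // big_mkcond /=.
apply: ler_sum => i _; case: ifP => [ir|_]; last by rewrite mulrn_wge0 ?exprn_ge0.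
by rewrite -[leRHS]mulr_natl; apply: ler_wpM2l => //; apply: ler_wiXn2l.
Qed.

Lemma K_lower_bound n r x : (r <= n)%N -> 0 <= x <= 1 ->
  2 ^+ n * x ^+ r <= (K n r)%:R * (1 + x) ^+ n.
Proof.
move=> rn x01; have /andP[x0 _] := x01.
have := ler_wpM2l (ler0n R (K n r)) (sum_bin_le rn x01).
apply: le_trans.
rewrite mulrA; apply: ler_wpM2r; first exact: exprn_ge0.
by rewrite -natrX -natrM ler_nat leq_expn_K.
Qed.

Lemma sum_bin_le_K n r : (16 * r <= n)%N ->
  (\sum_(i < r.+1) 'C(n, i))%N%:R * (16 / 15) ^+ n <= (K n r)%:R :> R.
Proof.
move=> rn; set V := (\sum_(i < r.+1) 'C(n, i))%N.
have rn' : (r <= n)%N by lia.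
have x01 : (0 <= 1 / 4 :> R) && (1 / 4 <= 1 :> R) by apply/andP; split; lra.
have VK : 2 ^+ n <= (K n r)%:R * V%:R :> R by rewrite -natrX -natrM ler_nat leq_expn_K.
have V2 : V%:R * V%:R <= (15 / 8) ^+ n :> R.
  have h : V%:R * (1 / 4) ^+ r <= (5 / 4) ^+ n :> R.
    apply: le_trans (sum_bin_le rn' x01) _.
    by rewrite (_ : 1 + 1 / 4 = 5 / 4 :> R) //; field.
  (* Here [2 <= (6 / 5) ^+ 4] gives [16 ^+ r <= (6 / 5) ^+ (16 * r)], and [16 * r <= n]. *)
  have h16 : 16 ^+ r <= (6 / 5) ^+ n :> R.
    have h2 : 2 <= (6 / 5) ^+ 4 :> R by rewrite !exprS expr0; lra.
    have -> : 16 = 2 ^+ 4 :> R by rewrite !exprS expr0; ring.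
    rewrite -exprM; apply: (@le_trans _ _ (((6 / 5) ^+ 4) ^+ (4 * r))).
      by apply: lerXn2r h2; rewrite nnegrE ?exprn_ge0 //; lra.
    by rewrite -exprM mulnA; apply: ler_weXn2l rn; lra.
  have w0 : 0 <= V%:R * (1 / 4) ^+ r :> R by rewrite mulr_ge0 ?exprn_ge0 //; lra.
  have -> : (15 / 8 : R) = 5 / 4 * (5 / 4) * (6 / 5) by field.
  have -> : V%:R * V%:R = (V%:R * (1 / 4) ^+ r) * (V%:R * (1 / 4) ^+ r) * 16 ^+ r :> R.
    have e : (1 / 4) ^+ r * (1 / 4) ^+ r * 16 ^+ r = 1 :> R.
      have -> : 16 = (1 / 4 * (1 / 4))^-1 :> R by field.
      by rewrite -!exprMn mulfV ?expr1n // lt0r_neq0 //; lra.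
    by rewrite mulrACA -[RHS]mulrA e mulr1.
  rewrite [leRHS]exprMn [X in _ <= X * _]exprMn.
  by apply: ler_pM h16; [exact: mulr_ge0|exact: exprn_ge0|exact: ler_pM].
have V0 := ler0n R V.
(* Multiplying the covering bound by [V] brings in [V2]; the ratio of 2 to 15/8 is 16/15. *)
have : V%:R * 2 ^+ n <= (K n r)%:R * (15 / 8) ^+ n :> R.
  by apply: le_trans (ler_wpM2l V0 VK) _; rewrite mulrCA ler_wpM2l.
rewrite (_ : 2 = 16 / 15 * (15 / 8)); last by field.
by rewrite exprMn mulrA ler_pM2r // exprn_gt0 //; lra.
Qed.

(* Chernoff's bound with x = z^2; the hypotheses on [z] are those satisfied by
   [expR (- y)] and give [(1 - y^2) * cosh y <= 1]. *)
Lemma chernoff_K n r y z : (r <= n)%N -> 0 <= y < 1 -> 1 - y <= z -> z * (1 + y) <= 1 ->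
  (1 - y ^+ 2) ^+ n * z ^+ (r.*2) <= (K n r)%:R * z ^+ n.
Proof.
move=> rn /andP[y0 y1] yz zy; have z0 : 0 < z by lra.
have z1 : z <= 1 by nra.
have x01 : 0 <= z ^+ 2 <= 1 by rewrite sqr_ge0 exprn_ile1 // ltW.
have := K_lower_bound rn x01; rewrite -exprM mul2n => h.
(* The two nonnegative products below add up to the right side minus the left. *)
have cosh : (1 - y ^+ 2) * (1 + z ^+ 2) <= 2 * z.
  have : 0 <= (z - (1 - y)) * (1 + y) by apply: mulr_ge0; lra.
  have : 0 <= z * ((1 - y) * (1 - z * (1 + y))).
    by apply: mulr_ge0; [lra|apply: mulr_ge0; lra].
  by rewrite !expr2; lra.
have y2 : 0 <= 1 - y ^+ 2 by rewrite subr_ge0 exprn_ile1 // ltW.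
rewrite -(@ler_pM2l _ (2 ^+ n)) ?exprn_gt0 // mulrCA.
apply: le_trans (ler_wpM2l (exprn_ge0 n y2) h) _.
rewrite mulrCA [leRHS]mulrCA -!exprMn; apply: ler_wpM2l => //.
by apply: lerXn2r cosh; rewrite ?nnegrE; nra.
Qed.

Lemma ln_le_log2 x : 1 <= x -> 0 <= ln x <= log2 x.
Proof.
move=> x1; rewrite ln_ge0 // /log2 ler_peMr ?ln_ge0 //.
have l2 : 0 < ln 2 :> R by rewrite ln_gt0 // ltr1n.
by rewrite -[leLHS]invr1 lef_pV2 ?posrE // -[2]/(1 + 1) le_ln1Dx; lra.
Qed.

Lemma K_ge_cube n r : (0 < n)%N ->
  r%:R <= n%:R / 2 - 3 * Num.sqrt n%:R * log2 (n%:R : R) ->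
  3 / 4 * n%:R ^+ 3 <= (K n r)%:R :> R.
Proof.
move=> n0 rn; pose q := Num.sqrt n%:R : R.
have n1 : 1 <= n%:R :> R by rewrite ler1n.
have qq : q ^+ 2 = n%:R by rewrite sqr_sqrtr ?ler0n.
have q1 : 1 <= q by rewrite -[1]sqrtr1 ler_wsqrtr.
have lnn := ln_le_log2 n1.
rewrite -/q in rn; set L := log2 _ in rn lnn; have /andP[lnn0 lnL] := lnn.
have qL : 0 <= q * L by apply: mulr_ge0; lra.
have rn' : (r <= n)%N by rewrite -(ler_nat R); lra.
(* This [y] makes [n * y ^ 2] equal to 1/4, so Bernoulli bounds [(1 - y ^ 2) ^ n] below by 3/4. *)
pose y := (2 * q)^-1; have yq : y * q = 1 / 2 by rewrite /y; field; lra.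
have y0 : 0 < y by rewrite invr_gt0; lra.
have y1 : y <= 1 / 2 by nra.
have zE : expR (- y) * expR y = 1 by rewrite -expRD addNr expR0.
have y01 : 0 <= y < 1 by lra.
have h1 : 1 - y <= expR (- y) by exact: expR_ge1Dx.
have h2 : expR (- y) * (1 + y) <= 1.
  by rewrite -[leRHS]zE ler_wpM2l ?expR_ge0 ?expR_ge1Dx.
have := chernoff_K rn' y01 h1 h2.
have y2 : n%:R * y ^+ 2 = 1 / 4.
  by rewrite -qq -exprMn mulrC yq; field.
have b : 3 / 4 <= (1 - y ^+ 2) ^+ n.
  have /(bernoulli_ineq n) : -1 <= - y ^+ 2 by nra.
  by apply: le_trans; rewrite mulrN y2; lra.
move=> /(le_trans (ler_wpM2r (exprn_ge0 _ (expR_ge0 _)) b)).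
rewrite -!expRM_natr -ler_pdivrMr ?expR_gt0 // -[X in X <= _ -> _]mulrA -expRN -expRD.
apply: le_trans; apply: ler_wpM2l; first lra.
rewrite -[X in X ^+ 3]lnK ?posrE; last lra.
rewrite -expRM_natr ler_expR -mul2n natrM.
(* Since [y * q = 1 / 2], this yields [y * (n - 2 * r) >= 3 * L >= 3 * ln n], whence the cube of
   [n]. *)
have : y * (2 * r%:R) <= y * (n%:R - 6 * (q * L)) by apply: ler_wpM2l; lra.
have -> : y * (n%:R - 6 * (q * L)) = y * n%:R - 6 * (y * q) * L by ring.
by rewrite yq; lra.
Qed.
End Asymptotics.

(** * Assembling the bounds *)

Lemma ceil_log2P (R : realType) (r : nat) :
  exists2 k : nat, r < 2 ^ k & ((Num.ceil (log2 (r%:R + 1 : R)))%:~R = k%:R :> R)%R.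
Proof.
set l := log2 _; have ln2 : (0 < ln 2 :> R)%R by rewrite ln_gt0 // ltr1n.
have r1 : (1 <= r%:R + 1 :> R)%R by rewrite lerDr ler0n.
have /andP[l0 ll] := ln_le_log2 r1.
have c0 : (0 <= Num.ceil l)%R by rewrite ceil_ge0 (lt_le_trans _ (le_trans l0 ll)) // ltrN10.
have kE : (`|Num.ceil l|%N%:R = (Num.ceil l)%:~R :> R)%R by rewrite natr_absz ger0_norm.
exists `|Num.ceil l|%N => //.
have r0 : (0 < r%:R + 1 :> R)%R := lt_le_trans ltr01 r1.
rewrite -(ler_nat R) natrX -natr1 -ler_ln ?posrE ?exprn_gt0 //.
by rewrite lnXn // -[leRHS]mulr_natl kE -ler_pdivrMr // ceil_ge.
Qed.

(** In (i), with [r = n], this makes the covering stage cost no query. *)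
Lemma K_diag n : K n n = 1.
Proof.
apply/eqP; rewrite eqn_leq K_gt0 andbT.
pose u : cube n := [tuple of nseq n true].
rewrite -(cards1 u); apply: covering_number_le.
rewrite /covering big_set1 -finset.subTset; apply/fintype.subsetP => v _.
by rewrite ball_cube hamming_max.
Qed.

Lemma search_number_le_K (R : realType) n r (P : pred nat) :
  (forall s, s <= r -> P s) ->
  (search_number (@cube_adj n) R P <=
   (((K n r).-1 + n.-1)%:R + (Num.ceil (log2 (r%:R + 1 : R)))%:~R)%R%:E)%E.
Proof.
move=> Pr; have [k rk ->] := ceil_log2P R r.
apply: le_trans (search_number_le R (solvable_le_K n Pr rk)) _.
by rewrite lee_fin -natrD ler_nat addnA addnAC.
Qed.

(** Common end of both asymptotic claims: [eps * K n r] absorbs the loss of 1 below and the [m]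
    extra queries above. *)
Lemma search_number_asymptotic (R : realType) n r m (P : pred nat) (eps : R) :
  subpred P (fun s => s <= r) -> (1 <= eps * (K n r)%:R)%R -> (m%:R <= eps * (K n r)%:R)%R ->
  solvable (@cube_adj n) P [set: cube n]%SET (K n r + m) ->
  (((1 - eps) * (K n r)%:R)%R%:E <= search_number (@cube_adj n) R P)%E /\
  (search_number (@cube_adj n) R P <= ((1 + eps) * (K n r)%:R)%R%:E)%E.
Proof.
move=> Pr K1 mK solv; split.
  apply: le_trans (search_number_ge_covering (@cube_adj n) R Pr).
  by rewrite lee_fin -/(K n r); lra.
by apply: le_trans (search_number_le R solv) _; rewrite lee_fin natrD; lra.
Qed.

Local Open Scope classical_set_scope.
Local Open Scope ring_scope.

Theorem theorem1p1 (R : realType) :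
  (* (i) *)
  (forall n : nat, (0 < n)%N ->
     (n%:R%:E <= A R n)%E /\
     (A R n <= (n%:R - 1 + (Num.ceil (log2 (n%:R + 1 : R)))%:~R)%:E)%E) /\
  (* (ii) *)
  ((forall n r : nat,
      (((K n r)%:R - 1)%:E <= A_le R n r)%E /\
      (A_le R n r <=
         ((K n r)%:R + n%:R - 1
          + (Num.ceil (log2 (r%:R + 1 : R)))%:~R)%:E)%E) /\
   (exists C : R, 0 < C /\
      forall eps : R, 0 < eps ->
        \forall n \near \oo, forall r : nat,
          r%:R <= n%:R / 2 - C * Num.sqrt n%:R * log2 (n%:R : R) ->
          (((1 - eps) * (K n r)%:R)%:E <= A_le R n r)%E /\
          (A_le R n r <= ((1 + eps) * (K n r)%:R)%:E)%E)) /\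
  (* (iii) *)
  ((forall n r : nat,
      (((K n r)%:R - 1)%:E <= A_eq R n r)%E /\
      ((r < n)%N ->
       (A_eq R n r <=
          ((K n r)%:R + (\sum_(0 <= i < r.+1) 'C(n, i))%N%:R)%:E)%E)) /\
   (exists C' : R, 0 < C' /\
      forall eps : R, 0 < eps ->
        \forall n \near \oo, forall r : nat,
          r%:R <= C' * n%:R ->
          (((1 - eps) * (K n r)%:R)%:E <= A_eq R n r)%E /\
          (A_eq R n r <= ((1 + eps) * (K n r)%:R)%:E)%E)).
Proof.
have eq_le r : subpred (fun s => s == r) (fun s => (s <= r)%N) by move=> s /eqP ->.
split; [|split; split].
- move=> n n0; split; first exact: A_ge.
  have := @search_number_le_K R n n predT.
  by rewrite K_diag add0n -subn1 natrB //; exact.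
- move=> n r; split; first exact: search_number_ge_covering.
  apply: le_trans (@search_number_le_K R n r (fun s => s <= r)%N (fun _ => id)) _.
  rewrite lee_fin lerD2r.
  by rewrite -natrD lerBrDr natr1 ler_nat; have := K_gt0 n r; lia.
- exists 3; split=> // eps eps0; near=> n => r rn.
  have n1 : 1 <= n%:R :> R by near: n; exact: nbhs_infty_ger.
  (* With [eps * n >= 3], the cubic bound gives [eps * K n r >= 9 / 4 * n ^ 2 >= 2 * n]. *)
  have ne : 3 / eps <= n%:R by near: n; exact: nbhs_infty_ger.
  have n0 : (0 < n)%N by rewrite -(ltr_nat R); lra.
  have Kn := K_ge_cube n0 rn.
  have rn' : (r <= n)%N.
    have /andP[l0 ll] := ln_le_log2 n1.
    have := mulr_ge0 (sqrtr_ge0 (n%:R : R)) (le_trans l0 ll).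
    by rewrite -(ler_nat R); lra.
  have nK : (2 * n)%N%:R <= eps * (K n r)%:R.
    rewrite ler_pdivrMr // in ne.
    apply: le_trans (ler_wpM2l (ltW eps0) Kn).
    have -> : eps * (3 / 4 * n%:R ^+ 3) = n%:R * eps * n%:R * (3 / 4 * n%:R) by field.
    rewrite natrM; nra.
  apply: (@search_number_asymptotic _ _ _ (2 * n)%N) => //.
    by apply: le_trans nK; rewrite natrM; lra.
  (* Here [r] bisection steps are affordable: [r + n.-1] is below [2 * n]. *)
  have rk : (r < 2 ^ r)%N by exact: ltn_expl.
  apply: solvable_sub (solvable_le_K n (P := fun s => (s <= r)%N) _ rk) => //.
  by lia.
- move=> n r; split; first exact: search_number_ge_covering.
  move=> rn; rewrite big_mkord -natrD.
  exact: search_number_le (solvable_eq_K rn).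
exists (1 / 16); split=> [|eps eps0]; first by lra.
near=> n => r rn.
have n1 : 1 <= n%:R :> R by near: n; exact: nbhs_infty_ger.
(* Bernoulli gives [(16 / 15) ^ n >= 1 + n / 15], so its product with [eps] is at least 1. *)
have ne : 15 / eps <= n%:R by near: n; exact: nbhs_infty_ger.
have rn' : (16 * r <= n)%N by rewrite -(ler_nat R) natrM; lra.
have n0 : (0 < n)%N by rewrite -(ltr_nat R); lra.
set m := (\sum_(i < r.+1) 'C(n, i))%N.
have m1 : 1 <= m%:R :> R by rewrite ler1n /m big_ord_recl bin0.
have mK : m%:R <= eps * (K n r)%:R.
  apply: le_trans (ler_wpM2l (ltW eps0) (sum_bin_le_K R rn')); rewrite -/m.
  have b : 1 + n%:R * (1 / 15) <= (16 / 15) ^+ n :> R.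
    by rewrite (_ : 16 / 15 = 1 + 1 / 15); [apply: bernoulli_ineq; lra|field].
  rewrite mulrCA ler_peMr ?ler0n //.
  apply: le_trans (ler_wpM2l (ltW eps0) b).
  by rewrite ler_pdivrMr // in ne; nra.
apply: (@search_number_asymptotic _ _ _ m) => //; first exact: le_trans mK.
by apply: solvable_eq_K; lia.
Unshelve. all: by end_near.
Qed.
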